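(* Let $h(n)$ be a positive integer function. Let $\mathcal{F}$ be obtained from the family of all graphs (finite, without isolated vertices) by omitting all graphs $H$ such that $H$ is not a star and $\mathrm{Ar}(n,H)\le h(n)$ for all $n\ge|H|$. Let $G$ be a graph without isolated vertices. (i) If $G\notin\mathcal{F}$, then $f(n,G|\mathcal{F})\le h(n)$ for all $n\ge |G|$. (ii) If $G\in\mathcal{F}$, then $f(n,G|\mathcal{F})=1$ for all sufficiently large $n$.
   Context: Stars are the graphs $K_{1,r}$, $r\ge 1$ (so $K_2$ is a star). The anti-Ramsey number $\mathrm{Ar}(n,H)$ is the smallest integer $k$ such that every edge coloring of $K_n$ with at least $k$ colors contains a copy of $H$ with all edges of mutually distinct colors (a rainbow copy). In an edge coloring of $K_n$ (not necessarily proper), for a copy $G'\subseteq K_n$ of a graph $G$, a color class of $G'$ is the graph (without isolated vertices) formed by all edges of $G'$ having a given color that occurs in $G'$. For a family $\mathcal{F}$ of graphs (closed under isomorphism) with $K_2\in\mathcal{F}$, and $n\ge |G|$, $f(n,G|\mathcal{F})$ is the smallest integer $m$ such that in every edge coloring of $K_n$ using at least $m$ colors there exists a copy of $G$ in which all color classes are members of $\mathcal{F}$. *)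

(* Defs.v *)
From mathcomp Require Import all_boot.
From mathcomp Require Import boolp.

Set Implicit Arguments.
Unset Strict Implicit.
Unset Printing Implicit Defensive.

Record sgraph := SGraph {
  vert :> finType;
  adj : rel vert;
  adj_sym : symmetric adj;
  adj_irrefl : irreflexive adj }.

Definition edges (G : sgraph) : {set {set G}} :=
  [set [set p.1; p.2] | p : G * G & adj p.1 p.2].

Definition no_isolated (G : sgraph) : Prop := forall x : G, exists y : G, adj x y.

Definition isomorphic (G H : sgraph) : Prop :=
  exists2 f : G -> H, bijective f & forall x y, adj (f x) (f y) = adj x y.

Definition K_adj (n : nat) (x y : 'I_n) : bool := x != y.

Fact K_sym (n : nat) : symmetric (@K_adj n).
Proof. by move=> x y; rewrite /K_adj eq_sym. Qed.

Fact K_irrefl (n : nat) : irreflexive (@K_adj n).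
Proof. by move=> x; rewrite /K_adj eqxx. Qed.

Definition K (n : nat) : sgraph := SGraph (@K_sym n) (@K_irrefl n).

(* K_{1,r}: the centre is None, the leaves are Some i. *)
Definition star_adj (r : nat) (x y : option 'I_r) : bool := (x == None) != (y == None).

Fact star_sym (r : nat) : symmetric (@star_adj r).
Proof. by move=> x y; rewrite /star_adj eq_sym. Qed.

Fact star_irrefl (r : nat) : irreflexive (@star_adj r).
Proof. by move=> x; rewrite /star_adj eqxx. Qed.

Definition star (r : nat) : sgraph := SGraph (@star_sym r) (@star_irrefl r).

Definition is_star (H : sgraph) : Prop := exists2 r, 0 < r & isomorphic H (star r).

(* The graph formed by a set E of edges: its vertices are only those covered
   by E, so that it has no isolated vertices. *)
Definition formed_adj (T : finType) (E : {set {set T}})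
    (x y : {v : T | v \in cover E}) : bool :=
  (x != y) && ([set val x; val y] \in E).

Fact formed_sym (T : finType) (E : {set {set T}}) : symmetric (@formed_adj T E).
Proof. by move=> x y; rewrite /formed_adj eq_sym setUC. Qed.

Fact formed_irrefl (T : finType) (E : {set {set T}}) :
  irreflexive (@formed_adj T E).
Proof. by move=> x; rewrite /formed_adj eqxx. Qed.

Definition formed (T : finType) (E : {set {set T}}) : sgraph :=
  SGraph (@formed_sym T E) (@formed_irrefl T E).

(* Only the values on [edges (K n)] are ever used. *)
Definition ecoloring (n : nat) : Type := {set K n} -> nat.

Definition num_colors (n : nat) (c : ecoloring n) : nat :=
  size (undup [seq c e | e <- enum (edges (K n))]).

(* A copy of G in K_n is given by an injection G -> K n; these are its edges. *)
Definition copy_edges (G : sgraph) (n : nat) (phi : G -> K n) : {set {set K n}} :=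
  [set phi @: e | e : {set G} in edges G].

Definition color_class (G : sgraph) (n : nat) (c : ecoloring n) (phi : G -> K n)
    (a : nat) : sgraph :=
  formed [set e in copy_edges phi | c e == a].

Definition has_rainbow_copy (H : sgraph) (n : nat) (c : ecoloring n) : Prop :=
  exists2 phi : H -> K n, injective phi & {in copy_edges phi &, injective c}.

Definition has_F_copy (F : sgraph -> Prop) (G : sgraph) (n : nat)
    (c : ecoloring n) : Prop :=
  exists2 phi : G -> K n, injective phi &
    forall e, e \in copy_edges phi -> F (color_class c phi (c e)).

(* The thresholds below range over positive integers: a coloring of K_n with
   n >= 2 uses at least one color, so a threshold 0 would mean the same as 1. *)
Definition forces (n : nat) (P : ecoloring n -> Prop) (m : nat) : Prop :=
  0 < m /\ forall c : ecoloring n, m <= num_colors c -> P c.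

Fact forces_ex (n : nat) (P : ecoloring n -> Prop) : exists m, `[< forces P m >].
Proof.
exists #|edges (K n)|.+1; apply/asboolP; split=> // c.
by rewrite ltnNge cardE -(size_map c) size_undup.
Qed.

Definition threshold (n : nat) (P : ecoloring n -> Prop) : nat :=
  ex_minn (forces_ex P).

Definition Ar (n : nat) (H : sgraph) : nat :=
  threshold (@has_rainbow_copy H n).

Definition f_num (n : nat) (G : sgraph) (F : sgraph -> Prop) : nat :=
  threshold (@has_F_copy F G n).

Definition ar_family (h : nat -> nat) (H : sgraph) : Prop :=
  no_isolated H /\
  ~ (~ is_star H /\ forall n, #|H| <= n -> Ar n H <= h n).

(* Main.v *)
Require Import Defs.
From mathcomp Require Import all_boot.
From mathcomp Require Import boolp.

(** Part (i) holds because the color classes of a rainbow copy are single edges,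
    hence stars, and stars are never omitted from the family.

    Part (ii) follows from a weak form of the Erdos-Rado canonical Ramsey theorem:
    every coloring of a large complete graph contains either a large monochromatic
    clique, inside which a copy of [G] has just one color class, isomorphic to [G],
    or a large clique all of whose color classes are stars
    ([canonical_ramsey]).  Requiring stars, instead of the rainbow and the
    lexical cliques of the full theorem, makes a greedy argument sufficient.

    A sequence of vertices is called [starry] when the colors joining each vertex
    to the later ones do not occur among the later ones; all edges of one color
    then share the earliest vertex that is incident with any of them
    ([starry_center]).  If in a large set [S] every vertex meets every color at
    most [d] times, a starry sequence is built by adding vertices one at a
    time, because each new vertex only has to avoid boundedly many pairs
    (old vertex, old color), each of which excludes at most [d] candidates
    ([starry_greedy]).  Otherwise some vertex has many neighbors in one color,
    and one continues inside that neighborhood.  If the greedy construction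
    never succeeds, this iteration yields a long lexical sequence, in which the
    color of an edge is determined by its earlier endpoint
    ([starry_or_lexical]).  By the pigeonhole principle, many of these colors
    agree, which gives a monochromatic clique, or many are distinct, which again
    gives a starry sequence. *)

Set Implicit Arguments.
Unset Strict Implicit.
Unset Printing Implicit Defensive.

(** * A canonical Ramsey theorem *)

Section CanonicalRamsey.

(** [c x y] stands for the color of the edge [xy].  The diagonal values [c x x]
    are arbitrary, but the greedy argument can treat them like any other color. *)
Variables (T : finType) (c : T -> T -> nat).

Fixpoint starry (s : seq T) : Prop :=
  if s is v :: s' then
    [/\ v \notin s', starry s' &
        forall x y z, x \in s' -> y \in s' -> z \in s' -> y != z ->
          c v x != c y z]
  else True.

Definition monochromatic (s : seq T) : Prop :=
  exists a, forall x y, x \in s -> y \in s -> x != y -> c x y = a.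

(** Each vertex is paired with the color that joins it to all later ones. *)
Definition lexical (s : seq (T * nat)) : bool :=
  pairwise (fun p q => (p.1 != q.1) && (c p.1 q.1 == p.2)) s.

Lemma starry_uniq s : starry s -> uniq s.
Proof. by elim: s => //= v s IHs [-> /IHs ->]. Qed.

(** The union bound behind the greedy choice of a vertex: each forbidden pair
    (old vertex, color) excludes at most [d] candidates. *)
Lemma avoid_pairs (S : {set T}) d (L : seq (T * nat)) :
  (forall p, p \in L -> #|[set w in S | c p.1 w == p.2]| <= d) ->
  size L * d < #|S| ->
  exists2 w, w \in S & forall p, p \in L -> c p.1 w != p.2.
Proof.
elim: L S => [|p L IHL] S Ld.
  by rewrite mul0n card_gt0 => /set0Pn[w wS]; exists w.
rewrite /= mulSn => ltS.
set B := [set w in S | c p.1 w == p.2].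
have BS : B \subset S by apply/subsetP=> w; rewrite inE => /andP[].
have leB : #|B| <= d by apply: Ld; rewrite mem_head.
case: (IHL (S :\: B)) => [q qL||w].
- apply: leq_trans (Ld q _); last by rewrite inE qL orbT.
  by apply/subset_leq_card/subsetP=> w; rewrite !inE => /andP[/andP[_ ->] ->].
- by rewrite cardsD (setIidPr BS) ltn_subRL; apply: leq_ltn_trans ltS; rewrite leq_add2r.
rewrite !inE negb_and => /andP[/orP[/negP//|cpw] wS] wL.
by exists w => // q; rewrite inE => /orP[/eqP->|/wL].
Qed.

(** The new vertex [w] avoids the values [c y z] with [y = z] as well: as the
    pair [(x, c x x)] excludes [w = x], this makes [w] a new vertex. *)
Lemma starry_greedy (S : {set T}) d m :
  (forall x y, c x y = c y x) ->
  (forall v a, v \in S -> #|[set w in S | c v w == a]| <= d) ->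
  m * (m * m) * d < #|S| ->
  exists s, [/\ size s = m, starry s & {subset s <= S}].
Proof.
move=> cC degS ltS.
suff: forall k, k <= m -> exists s, [/\ size s = k, starry s & {subset s <= S}].
  by apply.
elim=> [|k IHk] km; first by exists [::].
have [s [sz st sS]] := IHk (ltnW km).
pose L := [seq (x, b) | x <- s, b <- [seq c y z | y <- s, z <- s]].
have szL : size L = k * (k * k) by rewrite !size_allpairs sz.
have [p /allpairsP[[x b] /= [xs _ ->]] /=||w wS wL] := @avoid_pairs S d L.
- exact/degS/sS.
- rewrite szL; apply: leq_ltn_trans ltS.
  by rewrite leq_mul2r !leq_mul ?orbT // ltnW.
have wE x y z : x \in s -> y \in s -> z \in s -> c w x != c y z.
  move=> xs ys zs; rewrite cC; apply: (wL (x, c y z)).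
  by apply/allpairsP; exists (x, c y z); split=> //=; apply/allpairsP; exists (y, z).
exists (w :: s); split=> /=; first by rewrite sz.
  split=> [||x y z xs ys zs _]; [|exact: st|exact: wE].
  by apply/negP=> ws; have := wE w w w ws ws ws; rewrite eqxx.
by move=> x; rewrite inE => /orP[/eqP->|/sS].
Qed.

Lemma lexical_mono a s :
  (forall x y, c x y = c y x) ->
  lexical s -> all (fun p => p.2 == a) s -> monochromatic (unzip1 s).
Proof.
move=> cC lex_s sa; exists a; elim: s lex_s sa => //= p s IHs.
move=> /andP[/allP ps /IHs{}IHs] /andP[/eqP pa /IHs{}IHs].
have pE x : x \in unzip1 s -> c p.1 x = a.
  by case/mapP=> q /ps /andP[_ /eqP] + ->; rewrite pa.
move=> x y; rewrite !inE => /orP[/eqP->|xs] /orP[/eqP->|ys] //; last exact: IHs.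
- by rewrite eqxx.
- by rewrite pE.
- by rewrite cC pE.
Qed.

Lemma lexical_uniq s : lexical s -> uniq (unzip1 s).
Proof.
elim: s => //= p s IHs /andP[/allP ps /IHs ->]; rewrite andbT.
by apply/negP=> /mapP[q /ps /andP[/eqP]].
Qed.

(** The edges from a vertex to the later ones all carry its label, and every
    edge among the later ones carries the label of one of them. *)
Lemma lexical_starry s :
  (forall x y, c x y = c y x) ->
  lexical s -> uniq (unzip2 s) -> starry (unzip1 s).
Proof.
move=> cC; elim: s => //= p s IHs /andP[/allP ps lex_s] /andP[pn us].
split; [|exact: IHs|].
  by apply/negP=> /mapP[q /ps /andP[/eqP]].
have colors y z : y \in unzip1 s -> z \in unzip1 s -> y != z -> c y z \in unzip2 s.
  elim: s lex_s {IHs ps pn us} => //= q s IHs /andP[/allP qs /IHs{}IHs].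
  rewrite !inE => /orP[/eqP->|ys] /orP[/eqP->|zs]; first by rewrite eqxx.
  - by case/mapP: zs => r /qs /andP[_ /eqP<-] ->; rewrite eqxx.
  - by case/mapP: ys => r /qs /andP[_ /eqP<-] ->; rewrite cC eqxx.
  - by move=> yz; rewrite IHs ?orbT.
move=> _ y z /mapP[q /ps /andP[_ /eqP pq] ->] ys zs yz; rewrite pq.
by apply: contraNneq pn => ->; apply: colors.
Qed.

(** If every label occurs fewer than [m] times, keeping the first pair and
    deleting all pairs with its label costs at most [m] entries, so this can be
    repeated [k] times. *)
Lemma pigeonhole_labels m k (s : seq (T * nat)) :
  k * m <= size s ->
  (exists a, m <= count (fun p => p.2 == a) s) \/
  (exists t, [/\ subseq t s, size t = k & uniq (unzip2 t)]).
Proof.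
move=> szs; case: (pselect (exists a, m <= count (fun p => p.2 == a) s)).
  by left.
move=> few; right.
have {}few a : count (fun p => p.2 == a) s < m.
  by rewrite ltnNge; apply/negP=> ma; apply: few; exists a.
elim: k s szs few => [|k IHk] [|p s] szs few; try by exists [::]; rewrite ?sub0seq.
  by have := few 0; rewrite ltnNge (leq_trans _ szs) // leq_pmull.
pose s' := [seq q <- s | q.2 != p.2].
case: (IHk s') => [|a|t [ts szt ut]].
- have := few p.2; rewrite /= eqxx add1n size_filter => fewp.
  have := count_predC (fun q : T * nat => q.2 == p.2) s => /= sumE.
  rewrite -(leq_add2l m) -mulSn (leq_trans szs) //= -sumE -addSn.
  by rewrite leq_add2r ltnW.
- apply: leq_ltn_trans (few a); rewrite count_filter /=; apply: leq_trans (leq_addl _ _).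
  by apply: sub_count => q /andP[].
exists (p :: t); split=> /=; last 2 first.
- by rewrite szt.
- rewrite ut andbT; apply/negP=> /mapP[q /(mem_subseq ts)].
  by rewrite mem_filter => /andP[/eqP + _] pq; rewrite pq.
by rewrite eqxx (subseq_trans ts) ?filter_subseq.
Qed.

(** The recursion of this bound pays one step of [starry_greedy] for each
    further vertex of the lexical sequence. *)
Fixpoint lex_bound m l :=
  if l is l'.+1 then (m * (m * m) * lex_bound m l').+1 else 0.

Lemma starry_or_lexical m l (S : {set T}) :
  (forall x y, c x y = c y x) ->
  lex_bound m l <= #|S| ->
  (exists2 s, size s = m & starry s) \/
  (exists s, [/\ size s = l, lexical s & {subset unzip1 s <= S}]).
Proof.
move=> cC; elim: l S => [|l IHl] S leS; first by right; exists [::].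
set d := lex_bound m l in IHl leS.
case: (pselect (forall v a, v \in S -> #|[set w in S | c v w == a]| <= d)).
  by move=> /(starry_greedy cC)/(_ leS) [s [? ? _]]; left; exists s.
move=> /existsNP[v /existsNP[a /not_implyP[vS /negP]]]; rewrite -ltnNge.
set B := [set w in S | _] => ltB.
have leB : d <= #|B :\ v|.
  by have := cardsD1 v B; case: (v \in B) => BE; rewrite BE in ltB; rewrite // ltnW.
case: (IHl _ leB) => [|[s [sz lex_s sB]]]; [by left | right].
exists ((v, a) :: s); split=> /=; first by rewrite sz.
  apply/andP; split=> //; apply/allP=> q qs.
  have /sB : q.1 \in unzip1 s by apply: map_f.
  by rewrite !inE eq_sym => /and3P[-> _ ->].
move=> x; rewrite inE => /orP[/eqP-> //|/sB].
by rewrite !inE => /and3P[].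
Qed.

(** A lexical sequence of length [m * m] suffices, as it has [m] equal or [m]
    distinct labels. *)
Lemma canonical_ramsey m :
  (forall x y, c x y = c y x) -> lex_bound m (m * m) <= #|T| ->
  exists s, [/\ m <= size s, uniq s & monochromatic s \/ starry s].
Proof.
move=> cC; rewrite -cardsT => /(starry_or_lexical cC)[[s sz st]|[s [sz lex_s _]]].
  by exists s; rewrite sz leqnn starry_uniq //; split=> //; right.
have [|[a ma]|[t [ts szt ut]]] := @pigeonhole_labels m m s; first by rewrite sz.
  have lex_a := subseq_pairwise (filter_subseq (fun p => p.2 == a) s) lex_s.
  exists (unzip1 [seq p <- s | p.2 == a]); rewrite size_map size_filter.
  split=> //; first exact: lexical_uniq.
  by left; apply: lexical_mono lex_a _ => //; apply: filter_all.
have lex_t := subseq_pairwise ts lex_s.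
exists (unzip1 t); rewrite size_map szt lexical_uniq //; split=> //.
by right; apply: lexical_starry.
Qed.

(** If the first vertex [v] has an edge of color [a], then no edge among the later
    vertices has this color, so [v] is a center; otherwise [v] is irrelevant for
    the color [a] and can be dropped. *)
Lemma starry_center (v0 : T) a s :
  (forall x y, c x y = c y x) -> starry s ->
  exists v, forall x y, x \in s -> y \in s -> x != y -> c x y = a ->
    (v == x) || (v == y).
Proof.
move=> cC; elim: s => [|v s IHs] /=; first by exists v0.
case=> vs /IHs[u uP] vP.
case: (pselect (exists2 x, x \in s & c v x = a)) => [[w ws vwa]|nva].
  exists v => x y; rewrite !inE.
  move=> /orP[/eqP->|xs] /orP[/eqP->|ys] xy xya; rewrite ?eqxx ?orbT //.
  by have := vP w x y ws xs ys xy; rewrite vwa xya eqxx.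
exists u => x y; rewrite !inE => /orP[/eqP->|xs] /orP[/eqP->|ys] xy xya.
- by rewrite eqxx in xy.
- by case: nva; exists y.
- by case: nva; exists x; rewrite // cC.
- exact: uP.
Qed.

End CanonicalRamsey.

(** * Stars and isomorphisms *)

Lemma edgesP (G : sgraph) (e : {set G}) :
  reflect (exists x y, adj x y /\ e = [set x; y]) (e \in edges G).
Proof.
apply: (iffP imsetP) => [[[x y]]|[x [y [xy ->]]]].
  by rewrite inE => xy ->; exists x, y.
by exists (x, y); rewrite ?inE.
Qed.

Lemma adj_neq (G : sgraph) (x y : G) : adj x y -> x != y.
Proof. by apply: contraTneq => ->; rewrite adj_irrefl. Qed.

Lemma copy_edgesP (G : sgraph) n (phi : G -> K n) (e : {set K n}) :
  reflect (exists x y, adj x y /\ e = [set phi x; phi y])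
          (e \in copy_edges phi).
Proof.
apply: (iffP imsetP) => [[e' /edgesP[x [y [xy ->]]] ->]|[x [y [xy ->]]]].
  by exists x, y; rewrite imsetU1 imset_set1.
by exists [set x; y]; [apply/edgesP; exists x, y | rewrite imsetU1 imset_set1].
Qed.

Lemma star_of_center (H : sgraph) (v : H) :
  (exists x, x != v) ->
  (forall x y : H, adj x y = ((x == v) != (y == v))) -> is_star H.
Proof.
case=> x0 x0v adjE; pose L := {x : H | x != v}.
pose f (x : H) : star #|{: L}| := omap enum_rank (insub x : option L).
pose g (o : star #|{: L}|) : H := oapp (fun i => val (enum_val i)) v o.
have fK : cancel f g.
  move=> x; rewrite /f /g; case: insubP => [u _ <-|] /=; first by rewrite enum_rankK.
  by rewrite negbK => /eqP.
have gK : cancel g f.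
  case=> [i|]; rewrite /f /g /=; last by rewrite insubF ?eqxx.
  by rewrite valK /= enum_valK.
have f0 x : (f x == None) = (x == v).
  by rewrite /f; case: insubP => [u /negbTE -> _|] //; rewrite negbK => ->.
exists #|{: L}|; first by apply/card_gt0P; exists (Sub x0 x0v).
by exists f; [exists g | move=> x y; rewrite adjE /= /star_adj !f0].
Qed.

(** The leaves of the star are the covered vertices other than [v]: a covered
    vertex lies on an edge, and that edge joins it to [v]. *)
Lemma star_formed (T : finType) (E : {set {set T}}) (v : T) :
  E != set0 -> (forall e, e \in E -> exists2 x, x != v & e = [set v; x]) ->
  is_star (formed E).
Proof.
move=> /set0Pn[e0 e0E] EP; have [x0 x0v e0E'] := EP _ e0E.
have inE0 u : u \in e0 -> u \in cover E by move=> ue; apply/bigcupP; exists e0.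
have vE : v \in cover E by apply: inE0; rewrite e0E' !inE eqxx.
have x0E : x0 \in cover E by apply: inE0; rewrite e0E' !inE eqxx orbT.
apply: (@star_of_center _ (Sub v vE : formed E)); first by exists (Sub x0 x0E).
have leaf u : u \in cover E -> u != v -> [set v; u] \in E.
  case/bigcupP=> e eE; have [z _ eq_e] := EP _ eE.
  rewrite eq_e !inE => /orP[->//|/eqP->] _; by rewrite -eq_e.
case=> [x xE] [y yE]; rewrite /= /formed_adj -!val_eqE /=.
case: (eqVneq x v) xE => [->|xv] xE; case: (eqVneq y v) yE => [->|yv] yE //=.
- by rewrite leaf.
- by rewrite xv setUC leaf.
apply/negP=> /andP[_ /EP[z _ /setP/(_ v)]].
by rewrite !inE eqxx eq_sym (negbTE xv) eq_sym (negbTE yv).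
Qed.

Lemma no_isolated_formed (T : finType) (E : {set {set T}}) :
  (forall e, e \in E -> exists x y, x != y /\ e = [set x; y]) ->
  no_isolated (formed E).
Proof.
move=> EP [u uE]; case/bigcupP: (uE) => e eE ue.
have other w : w != u -> e = [set u; w] -> exists y : formed E, adj (Sub u uE : formed E) y.
  move=> wu eq_e.
  have wE : w \in cover E by apply/bigcupP; exists e; rewrite // eq_e !inE eqxx orbT.
  by exists (Sub w wE); rewrite /= /formed_adj -val_eqE /= eq_sym wu -eq_e.
have [x [y [xy eq_e]]] := EP _ eE; move: ue; rewrite eq_e !inE.
case/orP=> /eqP uE'; rewrite -uE' in xy eq_e.
  by apply: other eq_e; rewrite eq_sym.
by rewrite setUC in eq_e; apply: other eq_e.
Qed.

Lemma isomorphic_sym (G H : sgraph) : isomorphic G H -> isomorphic H G.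
Proof.
case=> f [g fK gK] fadj; exists g; first by exists f.
by move=> x y; rewrite -fadj !gK.
Qed.

Lemma isomorphic_trans (G H L : sgraph) :
  isomorphic G H -> isomorphic H L -> isomorphic G L.
Proof.
case=> f fB fadj [g gB gadj]; exists (g \o f); first exact: bij_comp.
by move=> x y; rewrite /= gadj fadj.
Qed.

(** * Thresholds and the family *)

Lemma threshold_le n (P : ecoloring n -> Prop) m :
  forces P m -> threshold P <= m.
Proof.
by rewrite /threshold; case: ex_minnP => k _ kP Pm; apply/kP/asboolP.
Qed.

Lemma threshold_forces n (P : ecoloring n -> Prop) : forces P (threshold P).
Proof. by rewrite /threshold; case: ex_minnP => k /asboolP. Qed.

(** A rainbow copy of [H] contains a rainbow copy of each of its subgraphs. *)
Lemma Ar_subgraph n (G H : sgraph) (f : G -> H) :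
  injective f -> (forall x y, adj x y -> adj (f x) (f y)) ->
  Ar n G <= Ar n H.
Proof.
move=> fI fadj; apply: threshold_le.
have [lt0 HP] := threshold_forces (@has_rainbow_copy H n).
split=> // c /HP[phi phiI phiR]; exists (phi \o f); first exact: inj_comp.
have sub e : e \in copy_edges (phi \o f) -> e \in copy_edges phi.
  case/copy_edgesP=> x [y [xy ->]]; apply/copy_edgesP.
  by exists (f x), (f y); split; first exact: fadj.
by move=> e e' /sub eE /sub e'E; apply: phiR.
Qed.

(** Needed because the color class of a monochromatic copy of [G] is not [G]
    itself but an isomorphic graph on vertices of [K n]. *)
Lemma ar_family_iso (h : nat -> nat) (G H : sgraph) :
  isomorphic G H -> ar_family h G -> ar_family h H.
Proof.
move=> GH [Giso GF]; have [f fB fadj] := GH.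
have [g fK gK] := fB; split.
  move=> x; have [y] := Giso (g x); rewrite -fadj gK.
  by exists (f y).
case=> Hstar HAr; apply: GF; split.
  case=> r r0 /(isomorphic_trans (isomorphic_sym GH)) Hr.
  by apply: Hstar; exists r.
move=> n; rewrite (bij_eq_card fB) => /HAr; apply: leq_trans.
by apply: (@Ar_subgraph n _ _ f (can_inj fK)) => x y; rewrite fadj.
Qed.

(** The common source of admissible color classes in both parts: when the edges
    of a color share a vertex, they form a star, and the family contains all
    stars whatever [h] is. *)
Lemma ar_family_star_class (h : nat -> nat) (G : sgraph) n (c : ecoloring n)
    (phi : G -> K n) (v : K n) e0 :
  injective phi -> e0 \in copy_edges phi ->
  (forall e, e \in copy_edges phi -> c e = c e0 -> v \in e) ->
  ar_family h (color_class c phi (c e0)).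
Proof.
move=> phiI e0E vP.
have edge e : e \in copy_edges phi -> exists x y, x != y /\ e = [set x; y].
  case/copy_edgesP=> x [y [/adj_neq xy ->]]; exists (phi x), (phi y).
  by rewrite (inj_eq phiI).
split.
  by apply: no_isolated_formed => e; rewrite inE => /andP[/edge].
case=> + _; apply; apply: (@star_formed _ _ v).
  by apply/set0Pn; exists e0; rewrite inE e0E eqxx.
move=> e; rewrite inE => /andP[eE /eqP/(vP _ eE)].
have [x [y [xy ->]]] := edge _ eE; rewrite !inE => /orP[/eqP->|/eqP->].
  by exists y; rewrite // eq_sym.
by exists x; rewrite // setUC.
Qed.

Lemma has_F_copy_rainbow (h : nat -> nat) (G : sgraph) n (c : ecoloring n) :
  has_rainbow_copy G c -> has_F_copy (ar_family h) G c.
Proof.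
case=> phi phiI phiR; exists phi => // e eE.
have [x [y [_ eE']]] := copy_edgesP _ _ eE.
apply: (@ar_family_star_class _ _ _ _ _ (phi x)) => // e' e'E /(phiR _ _ e'E eE) ->.
by rewrite eE' !inE eqxx.
Qed.

(** Without isolated vertices, the vertices covered by the edges of a copy are
    exactly the images of the vertices of [G]. *)
Lemma isomorphic_copy (G : sgraph) n (phi : G -> K n) :
  no_isolated G -> injective phi -> isomorphic G (formed (copy_edges phi)).
Proof.
move=> Giso phiI.
have phiE x : phi x \in cover (copy_edges phi).
  have [y xy] := Giso x; apply/bigcupP; exists [set phi x; phi y].
    by apply/copy_edgesP; exists x, y.
  by rewrite !inE eqxx.
pose f x : formed (copy_edges phi) := Sub (phi x) (phiE x).
have fI : injective f by move=> x y /(congr1 val) /= /phiI.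
exists f.
  have fS (u : formed (copy_edges phi)) : exists x, f x == u.
    case: u => u uE; have := uE; case/bigcupP=> e /copy_edgesP[x [y [_ ->]]].
    rewrite !inE => /orP[/eqP uE'|/eqP uE']; [exists x | exists y];
      by rewrite -val_eqE /= uE'.
  exists (fun u => xchoose (fS u)) => [x|u]; last exact/eqP/(xchooseP (fS u)).
  exact/fI/eqP/(xchooseP (fS (f x))).
move=> x y; rewrite /= /formed_adj -val_eqE /= (inj_eq phiI).
apply/andP/idP => [[xy /copy_edgesP[x' [y' [xy' /setP E]]]]|xy]; last first.
  by split; [exact: adj_neq | apply/copy_edgesP; exists x, y].
have := E (phi x); have := E (phi y); rewrite !inE !eqxx orbT !(inj_eq phiI) /=.
case/esym/orP=> /eqP yE /esym/orP[] /eqP xE; subst=> //; rewrite ?eqxx // in xy.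
by rewrite adj_sym.
Qed.

Lemma has_F_copy_large (h : nat -> nat) (G : sgraph) n (c : ecoloring n) :
  no_isolated G -> ar_family h G -> lex_bound #|G| (#|G| * #|G|) <= n ->
  has_F_copy (ar_family h) G c.
Proof.
move=> Giso GF leN; pose cc (x y : K n) := c [set x; y].
have ccC x y : cc x y = cc y x by rewrite /cc setUC.
have [|s [szs us sP]] := @canonical_ramsey (K n) cc #|G| ccC.
  by rewrite card_ord.
case: (pselect (exists x : G, True)) => [[x0 _]|G0]; last first.
  (* without vertices there are no copies of edges to check *)
  exists (fun x => False_rect _ (G0 (ex_intro _ x I))).
    by move=> x; case: G0; exists x.
  by move=> e /copy_edgesP[x]; case: G0; exists x.
have lts (x : G) : enum_rank x < size s by apply: leq_trans szs; apply: ltn_ord.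
have [v0 _] : exists v0 : K n, v0 \in s.
  by case: (s) (lts x0) => [|v s'] // _; exists v; rewrite mem_head.
pose phi (x : G) : K n := nth v0 s (enum_rank x).
have phis x : phi x \in s by apply: mem_nth.
have phiI : injective phi.
  move=> x y /eqP; rewrite nth_uniq // => /eqP E; exact/enum_rank_inj/ord_inj.
exists phi => // e eE; case: sP => [[a sa]|st].
  have allE e' : e' \in copy_edges phi -> c e' = a.
    case/copy_edgesP=> x [y [/adj_neq xy ->]]; apply: sa => //.
    by rewrite (inj_eq phiI).
  rewrite /color_class; have -> : [set e' in copy_edges phi | c e' == c e] = copy_edges phi.
    apply/setP=> e'; rewrite inE; case: (boolP (e' \in _)) => //= e'E.
    by rewrite !allE ?eqxx.
  exact: ar_family_iso (isomorphic_copy Giso phiI) GF.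
have [v vP] := @starry_center _ cc v0 (c e) s ccC st.
apply: (@ar_family_star_class _ _ _ _ _ v) => // e' /copy_edgesP[x [y [/adj_neq xy ->]]] cE.
by rewrite !inE; apply: vP => //; rewrite (inj_eq phiI).
Qed.

Theorem proposition8p3 (h : nat -> nat) (h_gt0 : forall n, 0 < h n)
    (G : sgraph) (G_no_isolated : no_isolated G) :
  (~ ar_family h G -> forall n, #|G| <= n -> f_num n G (ar_family h) <= h n) /\
  (ar_family h G -> exists N, forall n, N <= n -> f_num n G (ar_family h) = 1).
Proof.
split=> [GF n len|GF].
  have [_ GAr] : ~ is_star G /\ forall n, #|G| <= n -> Ar n G <= h n.
    by apply: contrapT => nG; apply: GF.
  apply: threshold_le; split=> // c hc; apply: has_F_copy_rainbow.
  have [_] := threshold_forces (@has_rainbow_copy G n); apply.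
  exact: leq_trans (GAr n len) hc.
exists (lex_bound #|G| (#|G| * #|G|)) => n leN; apply/eqP; rewrite eqn_leq.
apply/andP; split; last by case: (threshold_forces (@has_F_copy (ar_family h) G n)).
by apply: threshold_le; split=> // c _; apply: has_F_copy_large.
Qed.
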